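(* Let $T$ be a (finite) tree of order $m$ and diameter $d \geq 2$, let $n$ be a positive integer, and let $\varepsilon = \varepsilon(T)$. Then $$\mathrm{rn}(T \Box K_n) \geq (mn-1)(d+\varepsilon) - 2nL(T).$$
   Context: $d_G(u,v)$ denotes the graph distance and $\mathrm{diam}(G)$ the diameter of a connected graph $G$. A radio labelling of $G$ is a mapping $f:V(G)\to\{0,1,2,\ldots\}$ such that $|f(u)-f(v)| \geq \mathrm{diam}(G)+1-d_G(u,v)$ for every pair of distinct vertices $u,v$ of $G$. Its span is $\max\{|f(u)-f(v)| : u,v\in V(G)\}$, and the radio number $\mathrm{rn}(G)$ is the minimum span over all radio labellings of $G$. $K_n$ is the complete graph on $n$ vertices. The Cartesian product $G\Box H$ has vertex set $V(G)\times V(H)$, with $(a,b)$ adjacent to $(c,e)$ if either $a=c$ and $be\in E(H)$, or $b=e$ and $ac\in E(G)$. For a tree $T$ and $v\in V(T)$, put $w_T(v)=\sum_{u\in V(T)} d_T(u,v)$. A weight center of $T$ is a vertex minimizing $w_T$, and $W(T)$ is the set of weight centers of $T$ (it is known that $|W(T)|\in\{1,2\}$). The level of $u\in V(T)$ is $L(u)=\min\{d_T(u,x): x\in W(T)\}$, and the total level of $T$ is $L(T)=\sum_{u\in V(T)}L(u)$. Define $\varepsilon(T)=1$ if $|W(T)|=1$ and $\varepsilon(T)=0$ if $|W(T)|=2$. *)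

(* Defs.v *)
From HB Require Import structures.
From mathcomp Require Import all_boot all_order all_algebra.
From mathcomp Require Import boolp.

Set Implicit Arguments.
Unset Strict Implicit.
Unset Printing Implicit Defensive.

(* Finite simple graphs. *)
Record sgraph := SGraph {
  svertex :> finType;
  adj : rel svertex;
  adj_sym : symmetric adj;
  adj_irrefl : irreflexive adj }.

Section Distance.
Variable G : sgraph.

Definition walkb (k : nat) (u v : G) : bool :=
  [exists p : k.-tuple G, path (@adj G) u p && (last u p == v)].

(* The least length of a walk from u to v.  The search may stop at #|G|, since a
   shortest walk repeats no vertex; the value is #|G| when u and v lie in
   different components. *)
Definition dist (u v : G) : nat := find (fun k => walkb k u v) (iota 0 #|G|).

Definition diam : nat := \max_(u : G) \max_(v : G) dist u v.

Definition connected : Prop :=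
  0 < #|G| /\ forall u v : G, connect (@adj G) u v.

(* [c] lists the successive vertices of a cycle; size 2 would be one edge
   traversed back and forth. *)
Definition acyclic : Prop :=
  forall c : seq G, 2 < size c -> ~ ucycle (@adj G) c.

Definition is_tree : Prop := connected /\ acyclic.

Definition radio_labelling (f : G -> nat) : Prop :=
  forall u v : G, u != v -> diam + 1 - dist u v <= absz ((f u)%:Z - (f v)%:Z)%R.

Definition span (f : G -> nat) : nat :=
  \max_(u : G) \max_(v : G) absz ((f u)%:Z - (f v)%:Z)%R.

Definition is_radio_span (k : nat) : Prop :=
  exists2 f : G -> nat, radio_labelling f & span f = k.

Lemma radio_span_ex : exists k, `[< is_radio_span k >].
Proof.
pose f (u : G) := enum_rank u * (diam + 1).
exists (span f); apply/asboolP; exists f => // u v neq_uv.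
rewrite (leq_trans (leq_subr _ _)) // /f !PoszM -GRing.mulrBl abszM.
rewrite leq_pmull // lt0n absz_eq0 GRing.subr_eq0 eqz_nat.
by apply: contra neq_uv => /eqP/val_inj/enum_rank_inj->.
Qed.

Definition rn : nat := ex_minn radio_span_ex.

Definition weight (v : G) : nat := \sum_(u : G) dist u v.

Definition weight_centers : {set G} :=
  [set v | [forall u, weight v <= weight u]].

(* Minimum over the weight centers; #|G| bounds every distance, so it is neutral
   for [minn] here. *)
Definition level (u : G) : nat :=
  \big[minn/#|G|]_(x in weight_centers) dist u x.

Definition total_level : nat := \sum_(u : G) level u.

(* A tree has one or two weight centers, so this is 1 or 0 accordingly. *)
Definition eps : nat := if #|weight_centers| == 1 then 1 else 0.

End Distance.

Definition complete_rel (n : nat) : rel 'I_n := fun i j => i != j.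

Lemma complete_sym n : symmetric (@complete_rel n).
Proof. by move=> i j; rewrite /complete_rel eq_sym. Qed.

Lemma complete_irrefl n : irreflexive (@complete_rel n).
Proof. by move=> i; rewrite /complete_rel eqxx. Qed.

Definition complete (n : nat) : sgraph :=
  SGraph (@complete_sym n) (@complete_irrefl n).

Section CartesianProduct.
Variables G H : sgraph.

Definition cart_rel : rel (G * H) := fun x y =>
  (x.1 == y.1) && adj x.2 y.2 || (x.2 == y.2) && adj x.1 y.1.

Lemma cart_sym : symmetric cart_rel.
Proof.
move=> x y; rewrite /cart_rel ![y.1 == _]eq_sym ![y.2 == _]eq_sym.
by rewrite (adj_sym y.1) (adj_sym y.2).
Qed.

Lemma cart_irrefl : irreflexive cart_rel.
Proof. by move=> x; rewrite /cart_rel !adj_irrefl !andbF. Qed.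

Definition cart_prod : sgraph := SGraph cart_sym cart_irrefl.

End CartesianProduct.

(* Main.v *)
Require Import Defs.
From mathcomp Require Import all_boot all_order all_algebra.
From mathcomp Require Import boolp zify.

Set Implicit Arguments.
Unset Strict Implicit.
Unset Printing Implicit Defensive.

(** Let [f] be a radio labelling of the product [P] of [T] with the complete
    graph, and list the [m * n] vertices of [P] in increasing order of [f].  The
    span is at least the sum of the [m * n - 1] consecutive gaps, and every gap
    between [x] and [y] is at least [d + eps T - level x.1 - level y.1]:

    - Distances in a Cartesian product add up ([dist_cart]).  A complete graph
      has diameter at most 1, and passing from [T] to [P] raises the diameter
      by at least as much as it can raise any distance
      ([diam_cart_complete]), so the labelling condition forces a gap of at
      least [d + 1 - dist x.1 y.1].

    - Going through weight centers nearest to the two ends gives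
      [dist u v <= level u + level v + 1 - eps T] ([dist_le_levels]): when there
      is more than one center, any two of them are at distance at most 1.

    Summing up, each vertex of [P] is an end of at most two gaps, so at most
    twice the sum of all levels over [P] is subtracted; this sum is
    [n * total_level T] because the level depends only on the tree coordinate
    ([telescope]).

    That two weight centers are adjacent or equal is where the tree structure
    enters.  In a tree the weight is strictly convex along paths
    ([weight_convex]), because of two neighbours of [b] at least one is farther
    from any given vertex than [b] itself ([dist_neighbours]).  A strictly
    convex sequence cannot take its minimum at both ends of a path of length
    more than 1. *)

(** * Walks and distance *)

Section Walks.
Variable G : sgraph.
Implicit Types (u v w x y : G) (p : seq G) (k : nat).

Lemma walkP k u v :
  reflect (exists p, [/\ size p = k, path (@adj G) u p & last u p = v])
          (walkb k u v).
Proof.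
apply: (iffP existsP) => [[p /andP[pp /eqP lp]] | [p [sp pp lp]]].
  by exists p; rewrite size_tuple.
by exists (Tuple (introT eqP sp)); rewrite /= pp lp eqxx.
Qed.

Lemma walk0 u : walkb 0 u u.
Proof. by apply/walkP; exists [::]. Qed.

Lemma walk1 u v : adj u v -> walkb 1 u v.
Proof. by move=> uv; apply/walkP; exists [:: v]; rewrite /= uv. Qed.

Lemma walk_cat k l u v w : walkb k u v -> walkb l v w -> walkb (k + l) u w.
Proof.
move=> /walkP[p [<- pp <-]] /walkP[q [<- pq <-]]; apply/walkP.
by exists (p ++ q); rewrite size_cat cat_path pp last_cat.
Qed.

Lemma walk_sym k u v : walkb k u v = walkb k v u.
Proof.
suff imp x y : walkb k x y -> walkb k y x by apply/idP/idP; apply: imp.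
move=> /walkP[p [<- pp <-]]; apply/walkP.
exists (rev (belast x p)); rewrite size_rev size_belast; split=> //.
  rewrite -rev_path in pp.
  by apply: sub_path pp => a b; rewrite adj_sym.
by case: p {pp} => //= a p; rewrite rev_cons last_rcons.
Qed.

(** Distances are capped at [#|G|], so the bound also holds for walks too long
    to be examined by the search that defines [dist]. *)
Lemma dist_le_walk k u v : walkb k u v -> dist u v <= k.
Proof.
move=> w; rewrite /dist; have [kG|Gk] := ltnP k #|G|; last first.
  by rewrite (leq_trans (find_size _ _)) ?size_iota.
rewrite leqNgt; apply/negP => lt_k.
by have := before_find 0 lt_k; rewrite nth_iota // add0n w.
Qed.

Lemma dist_le_card u v : dist u v <= #|G|.
Proof. by rewrite (leq_trans (find_size _ _)) ?size_iota. Qed.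

Lemma dist_sym u v : dist u v = dist v u.
Proof. by apply: eq_find => k; apply: walk_sym. Qed.

(** Removing the loops of a walk leaves fewer than [#|G|] steps, so in a
    connected component the search defining [dist] does succeed. *)
Lemma dist_walk u v : connect (@adj G) u v -> walkb (dist u v) u v.
Proof.
move=> /connectP[p pp ->]; case/shortenP: pp => q pq uq _ {p}.
have lt_q : size q < #|G| 
  by rewrite -[(size q).+1]/(size (u :: q)) -(card_uniqP uq) max_card.
have : has (fun k => walkb k u (last u q)) (iota 0 #|G|).
  apply/hasP; exists (size q); first by rewrite mem_iota.
  by apply/walkP; exists q.
move=> hq; have := nth_find 0 hq; rewrite nth_iota //.
by rewrite -[X in _ < X](size_iota 0) -has_find.
Qed.

Lemma dist_triangle u v w :
  connected G -> dist u w <= dist u v + dist v w.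
Proof.
by case=> _ cG; apply/dist_le_walk/(@walk_cat _ _ _ v); apply/dist_walk/cG.
Qed.

Lemma dist_gt0 u v : connected G -> u != v -> 0 < dist u v.
Proof.
case=> _ cG; rewrite lt0n; apply: contraNneq => d0.
by have /walkP[[|? ?] []] := dist_walk (cG u v); rewrite d0 // => _ _ /= ->.
Qed.

Lemma diam_attained : 0 < #|G| -> exists u v, diam G = dist u v.
Proof.
move=> G0; rewrite /diam.
have [u ->] := eq_bigmax (fun u => \max_(v : G) dist u v) G0.
by have [v ->] := eq_bigmax (dist u) G0; exists u, v.
Qed.

Lemma dist_le_diam u v : dist u v <= diam G.
Proof.
apply: leq_trans (leq_bigmax v) _.
exact: (leq_bigmax (F := fun u => \max_v dist u v) u).
Qed.

(** Weight centers exist since the graph has the vertex [u], and distances never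
    exceed the default value [#|G|] of the minimum. *)
Lemma level_attained u :
  exists2 x, x \in weight_centers G & level u = dist u x.
Proof.
have [x0 x0W] : exists x, x \in weight_centers G.
  exists (fintype.arg_min u xpredT (@weight G)); rewrite inE.
  by case: arg_minnP => // x _ le_x; apply/forallP => v; apply: le_x.
suff [lvl|//] : level u = #|G| \/
    exists2 x, x \in weight_centers G & level u = dist u x.
  exists x0 => //; apply/eqP; rewrite lvl eqn_leq dist_le_card andbT -lvl.
  (* [minn] has no neutral element on [nat], so [bigD1] does not apply *)
  rewrite /level; elim: (index_enum _) (mem_index_enum x0) => //= y r IHr.
  rewrite inE big_cons => /predU1P[<-|/IHr le_r]; first by rewrite x0W geq_minl.
  by case: ifP => // _; apply: leq_trans le_r; apply: geq_minr.
rewrite /level; apply: (big_ind (fun l => l = #|G| \/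
    exists2 x, x \in weight_centers G & l = dist u x)).
- by left.
- by move=> a b Ha Hb; rewrite /minn; case: ifP.
- by move=> x xW; right; exists x.
Qed.

End Walks.

(** * The product with a complete graph *)

Section Product.
Variables G H : sgraph.
Implicit Types x y : cart_prod G H.

Lemma walk_cart k l x y :
  walkb k x.1 y.1 -> walkb l x.2 y.2 -> walkb (k + l) x y.
Proof.
case: x y => [a b] [c e] /= wG wH.
have [wb wc] : @walkb (cart_prod G H) k (a, b) (c, b) /\
               @walkb (cart_prod G H) l (c, b) (c, e).
  split; apply/walkP.
    have /walkP[p [<- pp <-]] := wG.
    exists (map (pair^~ b) p); rewrite size_map last_map; split=> //.
    rewrite path_map; apply: sub_path pp => s t st.
    by rewrite /= /cart_rel /= st eqxx orbT.
  have /walkP[p [<- pp <-]] := wH.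
  exists (map (pair c) p); rewrite size_map last_map; split=> //.
  rewrite path_map; apply: sub_path pp => s t st.
  by rewrite /= /cart_rel /= st eqxx.
exact: walk_cat wb wc.
Qed.

(** Each step of a walk in the product moves exactly one coordinate. *)
Lemma walk_proj k x y : walkb k x y ->
  exists i j, [/\ k = i + j, walkb i x.1 y.1 & walkb j x.2 y.2].
Proof.
move=> /walkP[p [<-]]; elim: p x {k} => [|z p IHp] x /=.
  by move=> _ <-; exists 0, 0; rewrite !walk0.
move=> /andP[xz pp] lp; have [i [j [-> wi wj]]] := IHp z pp lp.
case/orP: xz => /andP[/eqP E adj_xz].
  exists i, (1 + j); rewrite E; split=> //; first by rewrite addnCA.
  exact: walk_cat (walk1 adj_xz) wj.
exists (1 + i), j; rewrite E; split=> //.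
exact: walk_cat (walk1 adj_xz) wi.
Qed.

(** Geodesics of the factors, run one after the other, give a walk in the
    product; conversely the steps of a geodesic of the product are shared out
    between its two projections. *)
Lemma dist_cart x y : connected G -> connected H ->
  dist x y = dist x.1 y.1 + dist x.2 y.2.
Proof.
move=> [_ cG] [_ cH].
have w := walk_cart (dist_walk (cG x.1 y.1)) (dist_walk (cH x.2 y.2)).
apply/eqP; rewrite eqn_leq dist_le_walk //=.
have /dist_walk/walk_proj[i [j [-> wi wj]]] : connect (@adj (cart_prod G H)) x y.
  by apply/connectP; have /walkP[p [_ pp <-]] := w; exists p.
by rewrite leq_add ?dist_le_walk.
Qed.

End Product.

Lemma connected_complete n : 0 < n -> connected (complete n).
Proof.
move=> n0; split; first by rewrite card_ord.
move=> i j; have [->|ij] := eqVneq i j; first exact: connect0.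
exact: connect1.
Qed.

Lemma dist_complete n (i j : complete n) : 0 < n -> dist i j = (i != j).
Proof.
move=> n0; apply/eqP; rewrite eqn_leq; have [<-|ij] := eqVneq i j.
  by rewrite dist_le_walk ?walk0.
by rewrite dist_le_walk ?walk1 ?dist_gt0 //; apply: connected_complete.
Qed.

(** Two vertices realizing the diameter of [G] get one step farther apart when
    they are placed in distinct copies, which exist as soon as [1 < n]. *)
Lemma diam_cart_complete (G : sgraph) n : connected G -> 0 < n ->
  diam G + (1 < n) <= diam (cart_prod G (complete n)).
Proof.
move=> cG n0; have [u [v ->]] := diam_attained cG.1.
have [i [j ij]] : exists i j : complete n, (i != j) = (1 < n).
  have [n1|n1] := ltnP 1 n.
    by exists (Ordinal n0), (Ordinal n1).
  by exists (Ordinal n0), (Ordinal n0); rewrite eqxx.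
have := @dist_le_diam (cart_prod G (complete n)) (u, i) (v, j).
by rewrite dist_cart ?dist_complete ?ij //; apply: connected_complete.
Qed.

(** * Weight centers of a tree *)

Section Tree.
Variable T : sgraph.
Hypothesis treeT : is_tree T.
Let cT : connected T := treeT.1.
Implicit Types (a b c u v : T).

Definition adj_avoiding b : rel T :=
  [rel x y | adj x y && ((x != b) && (y != b))].

(** A path from [a] to [c] that avoids their common neighbour [b] closes up to a
    cycle through [b]. *)
Lemma no_detour b a c : adj b a -> adj b c -> a != c ->
  ~~ connect (adj_avoiding b) a c.
Proof.
move=> ba bc ac; apply/negP => /connectP[p pp lp].
move: ac bc; rewrite lp; case/shortenP: pp => q pq uq _ ac bc {p lp}.
have bq : b \notin q.
  elim: q a pq {ac uq bc ba} => //= x q IHq a /andP[/andP[_ /andP[_ xb]] pq].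
  by rewrite inE eq_sym negb_or xb (IHq x).
apply: (treeT.2 (b :: a :: q)).
  by case: q ac {pq uq bc bq} => //=; rewrite eqxx.
rewrite /ucycle /cycle /= in uq *; rewrite ba uq rcons_path inE negb_or bq.
have -> : b != a by apply: contraTneq ba => ->; rewrite adj_irrefl.
rewrite adj_sym bc !andbT; apply: sub_path pq => x y /=; by case/andP.
Qed.

(** Distances from [u] along a geodesic increase by 1 at each step, so the only
    vertex at distance [dist u a] or more is its end [a]. *)
Lemma geodesic_avoids u a b : a != b -> dist u a <= dist u b ->
  connect (adj_avoiding b) u a.
Proof.
move=> ab le_ab; have /walkP[p [sp pp lp]] := dist_walk (cT.2 u a).
apply/connectP; exists p => //.
have nth_b i : i <= size p -> nth u (u :: p) i != b.
  move=> le_i; apply: contra_neq ab => Eb.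
  have le_bi : dist u b <= i.
    apply: dist_le_walk; apply/walkP; exists (take i p); rewrite size_takel //.
    split=> //; first exact: take_path.
    rewrite (last_nth u) size_takel // -Eb.
    by rewrite -[u :: take i p]/(take i.+1 (u :: p)) nth_take.
  have {}le_i : i = size p.
    by apply/eqP; rewrite eqn_leq le_i sp (leq_trans le_ab).
  by rewrite -Eb -lp (last_nth u) le_i.
apply/(pathP u) => i lt_i; rewrite /adj_avoiding /= (nth_b i (ltnW lt_i)).
by rewrite (nth_b i.+1 lt_i) !andbT; apply: (pathP u pp).
Qed.

(** Otherwise geodesics from [u] to [a] and to [c] both avoid [b], and together
    they connect [a] to [c] around [b].  This covers at once the two ways in
    which a neighbour of [b] could fail to be farther away, being closer or
    being equally far. *)
Lemma dist_neighbours u a b c : adj b a -> adj b c -> a != c ->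
  (dist u b < dist u a) || (dist u b < dist u c).
Proof.
move=> ba bc ac; apply: contraT; rewrite negb_or -!leqNgt => /andP[la lc].
have nb x : adj b x -> x != b.
  by apply: contraTneq => ->; rewrite adj_irrefl.
have sym : connect_sym (adj_avoiding b).
  apply: sym_connect_sym => x y.
  by rewrite /adj_avoiding /= adj_sym [(x != b) && _]andbC.
have := no_detour ba bc ac; rewrite -(same_connect sym (_ : connect _ u a)).
  by rewrite geodesic_avoids ?nb.
by rewrite geodesic_avoids ?nb.
Qed.

Lemma dist_adj_le u a b : adj b a -> dist u b <= (dist u a).+1.
Proof.
move=> ba; rewrite -addn1; apply: leq_trans (dist_triangle u a b cT) _.
by rewrite leq_add2l dist_le_walk ?walk1 // adj_sym.
Qed.

(** Each vertex contributes a convex term: one of [a], [c] is farther than [b]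
    and the other is closer by at most 1.  Strictness comes from the term of [b]
    itself, which is 0 at [b] and positive at [a] and [c]. *)
Lemma weight_convex a b c : adj b a -> adj b c -> a != c ->
  (weight b).*2 < weight a + weight c.
Proof.
move=> ba bc ac; rewrite /weight -addnn -!big_split /=.
have dist_convex u : dist u b + dist u b <= dist u a + dist u c.
  have := dist_neighbours u ba bc ac.
  have := dist_adj_le u ba; have := dist_adj_le u bc; lia.
rewrite (bigD1 b) //= [X in _ < X](bigD1 b) //=.
rewrite -addSn leq_add ?leq_sum //.
have d0 : dist b b = 0 by apply/eqP; rewrite -leqn0 dist_le_walk ?walk0.
have : 0 < dist b a.
  by apply: dist_gt0 => //; apply: contraTneq ba => <-; rewrite adj_irrefl.
by rewrite d0; lia.
Qed.

(** Along a path the increments of the weight strictly increase, so once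
    nonnegative they are at least 1 at each later step. *)
Lemma weight_grows a b p : weight a <= weight b ->
  path (@adj T) a (b :: p) -> uniq (a :: b :: p) ->
  weight b + size p <= weight (last b p).
Proof.
elim: p a b => [|c p IHp] a b le_ab; first by rewrite addn0.
move=> /= /andP[ab /andP[bc pp]] /and3P[a_bcp b_cp ucp].
have ac : a != c by apply: contraNneq a_bcp => ->; rewrite !inE eqxx orbT.
have lt_bc : weight b < weight c.
  by have := @weight_convex a b c; rewrite adj_sym => /(_ ab bc ac); lia.
have := IHp b c (ltnW lt_bc); rewrite /= bc b_cp => /(_ pp ucp); lia.
Qed.

(** From a center [u] the first step of the path to [v] cannot decrease the
    weight, and any further step would make the weight of [v] too large. *)
Lemma dist_weight_centers u v :
  u \in weight_centers T -> v \in weight_centers T -> dist u v <= 1.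
Proof.
rewrite !inE => /forallP minu /forallP minv.
have /connectP[p0 pp0 lv] := cT.2 u v.
move: minv; rewrite lv; case/shortenP: pp0 => p pp up _ {p0 lv} minv.
apply: (@leq_trans (size p)); first by apply/dist_le_walk/walkP; exists p.
case: p pp up minv => [|a p] // pp up minv.
have := weight_grows (minu a) pp up; have := minv u; have := minu a => /=; lia.
Qed.

(** A unique center serves both [u] and [v], so the detour through it has no
    middle part; otherwise the two nearest centers are at most one step apart. *)
Lemma dist_le_levels u v : dist u v + eps T <= level u + level v + 1.
Proof.
have [x xW ->] := level_attained u; have [y yW ->] := level_attained v.
have xy : dist x y + eps T <= 1.
  rewrite /eps; case: ifP => [/cards1P[z W1]|_]; last first.
    by rewrite addn0 dist_weight_centers.
  move: xW yW; rewrite W1 !inE => /eqP-> /eqP->.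
  by rewrite addn1 ltnS dist_le_walk ?walk0.
have := dist_triangle u x v cT; have := dist_triangle x y v cT.
rewrite (dist_sym v y); lia.
Qed.

End Tree.

(** * The telescoping bound *)

Section Telescope.
Variables (V : finType) (f l : V -> nat) (D : nat).
Hypothesis far : forall u v, u != v ->
  D <= l u + l v + absz ((f u)%:Z - (f v)%:Z)%R.

(** The first vertex of the list is an end of one gap only, so one copy of its
    [l] in the doubled sum is left over.  In the induction the copy left over by
    the tail pays for the gap between [x] and the next vertex. *)
Lemma telescope_sorted x s : sorted (fun u v => f u <= f v) (x :: s) ->
  uniq (x :: s) ->
  f x + size s * D + l x <= f (last x s) + (\sum_(u <- x :: s) l u).*2.
Proof.
elim: s x => [|y s IHs] x; first by rewrite big_seq1 /=; lia.
rewrite big_cons => /= /andP[xy ss] /andP[x_ys us].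
have neq_xy : x != y by apply: contraNneq x_ys => ->; rewrite inE eqxx.
have := IHs y ss us; have := far neq_xy; rewrite mulSn /=; lia.
Qed.

Lemma telescope : 0 < #|V| -> exists u v : V,
  (#|V|.-1 * D <= absz ((f u)%:Z - (f v)%:Z)%R + (\sum_u l u).*2).
Proof.
move=> V0; pose s := sort (fun u v => f u <= f v) (enum V).
have ss : sorted (fun u v => f u <= f v) s.
  by apply: sort_sorted => u v; apply: leq_total.
have us : uniq s by rewrite sort_uniq enum_uniq.
have sz : size s = #|V| by rewrite size_sort -cardE.
have -> : \sum_u l u = \sum_(u <- s) l u.
  rewrite -big_enum /=; apply: perm_big.
  by rewrite perm_sym perm_sort.
case: s ss us sz => [|x s] ss us sz; first by rewrite -sz in V0.
exists (last x s), x; have := telescope_sorted ss us; rewrite -sz /=; lia.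
Qed.

End Telescope.

Theorem theorem3p1 (T : sgraph) (m d n : nat)
  (treeT : is_tree T) (orderT : #|T| = m) (diamT : diam T = d)
  (d_ge2 : (2 <= d)%N) (n_gt0 : (0 < n)%N) :
  (((m%:Z * n%:Z - 1) * (d%:Z + (eps T)%:Z) - 2 * n%:Z * (total_level T)%:Z)
     <= (rn (cart_prod T (complete n)))%:Z)%R.
Proof.
rewrite /rn; case: ex_minnP => k /asboolP[f radio_f <-] _.
have cT := treeT.1; have cK := connected_complete n_gt0.
have far (x y : cart_prod T (complete n)) : x != y ->
    d + eps T <= level x.1 + level y.1 + absz ((f x)%:Z - (f y)%:Z)%R.
  move=> /radio_f; have := diam_cart_complete cT n_gt0.
  have := dist_le_levels treeT x.1 y.1.
  rewrite dist_cart // dist_complete // diamT.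
  (* the step between copies is compensated by the larger diameter *)
  have : (x.2 != y.2) <= (1 < n).
    case: (ltnP 1 n) => [_|n1]; first exact: leq_b1.
    have -> : x.2 = y.2.
      apply: (@ord_inj n).
      have := @ltn_ord n x.2; have := @ltn_ord n y.2; lia.
    by rewrite eqxx.
  lia.
have cardP : #|cart_prod T (complete n)| = m * n.
  by rewrite card_prod card_ord orderT.
have m_gt0 : 0 < m by rewrite -orderT; case: cT.
have P_gt0 : 0 < #|cart_prod T (complete n)| by rewrite cardP muln_gt0 m_gt0.
have [u [v]] := telescope (V := cart_prod T (complete n)) far P_gt0.
have le_span : absz ((f u)%:Z - (f v)%:Z)%R <= Defs.span f.
  apply: leq_trans (leq_bigmax (F := fun v => absz ((f u)%:Z - (f v)%:Z)%R) v) _.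
  exact: (leq_bigmax (F := fun u => \max_v absz ((f u)%:Z - (f v)%:Z)%R) u).
have -> : \sum_(x : cart_prod T (complete n)) level x.1 = n * total_level T.
  rewrite -(pair_bigA _ (fun (a : T) (i : 'I_n) => level a)) /=.
  under eq_bigr do rewrite sum_nat_const card_ord.
  by rewrite -big_distrr.
rewrite cardP => le_tel.
have mn_gt0 : 0 < m * n by rewrite muln_gt0 m_gt0.
nia.
Qed.
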